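(* There exists an absolute constant $C>0$ such that for every integer $d>1$, $$\operatorname{LCJ}(\mathbb{R}^d)\le C\, d^{-\frac12}(\log d)^{\frac12},$$ where $\mathbb{R}^d$ is equipped with the standard Euclidean norm.
   Context: Let $a<b$ be real numbers and let $\mathcal{X}=(\mathcal{X},\rho)$ be a metric space. For a map $\gamma\colon[a,b]\to\mathcal{X}$ (no continuity assumed) set $$\operatorname{V}_\gamma=\sup\sum_{i=1}^N\rho(\gamma(t_{i-1}),\gamma(t_i)),$$ the supremum being over all finite tuples $a=t_0<t_1<\dots<t_N=b$. Write $\gamma\in\operatorname{BV}([a,b],\mathcal{X})$ if $\operatorname{V}_\gamma<\infty$. For $f\colon\mathcal{X}\to\mathbb{R}$ let $L_f=\sup_{x_1\neq x_2}|f(x_1)-f(x_2)|/\rho(x_1,x_2)$ be its global Lipschitz constant, and set $$\operatorname{LV}_\gamma=\sup\{\operatorname{V}_{f\circ\gamma} \mid f\colon\mathcal{X}\to\mathbb{R},\ L_f\le 1\}.$$ Define $$\operatorname{LCJ}(\mathcal{X})=\inf\left\{\frac{\operatorname{LV}_\gamma}{\operatorname{V}_\gamma}\ \Big|\ \gamma\in\operatorname{BV}([a,b],\mathcal{X})\right\},$$ the quotient being considered only for $\gamma$ with $\operatorname{V}_\gamma>0$. *)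

(* Defs.v *)
From HB Require Import structures.
From mathcomp Require Import all_boot all_order all_algebra.
From mathcomp Require Import ring lra.
From mathcomp Require Import all_classical all_reals all_analysis.

Set Implicit Arguments.
Unset Strict Implicit.
Unset Printing Implicit Defensive.

Import Order.TTheory GRing.Theory Num.Theory.
Import numFieldNormedType.Exports.

Local Open Scope classical_set_scope.
Local Open Scope ring_scope.

Section euclidean_norm.
Context {R : realType} {d : nat}.
Implicit Types x y : 'rV[R]_d.

Definition eucl_norm x : R := Num.sqrt (\sum_(i < d) x ord0 i ^+ 2).

Lemma eucl_norm_ge0 x : 0 <= eucl_norm x.
Proof. exact: sqrtr_ge0. Qed.

Lemma sqr_eucl_norm x : eucl_norm x ^+ 2 = \sum_(i < d) x ord0 i ^+ 2.
Proof. by rewrite sqr_sqrtr// sumr_ge0// => i _; rewrite sqr_ge0. Qed.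

Lemma eucl_norm0 : eucl_norm 0 = 0.
Proof. by rewrite /eucl_norm big1 ?sqrtr0// => i _; rewrite mxE expr0n. Qed.

Lemma eucl_norm_eq0 x : eucl_norm x = 0 -> x = 0.
Proof.
move=> x0; apply/rowP => i; rewrite mxE; apply/eqP; rewrite -sqrf_eq0.
have /eqP := sqr_eucl_norm x; rewrite x0 expr0n/= eq_sym psumr_eq0; last first.
  by move=> j _; rewrite sqr_ge0.
by move/allP; apply; rewrite mem_index_enum.
Qed.

Lemma eucl_normN x : eucl_norm (- x) = eucl_norm x.
Proof. by congr Num.sqrt; apply: eq_bigr => i _; rewrite mxE sqrrN. Qed.

Lemma eucl_cauchy_schwarz x y :
  \sum_(i < d) x ord0 i * y ord0 i <= eucl_norm x * eucl_norm y.
Proof.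
have [/eucl_norm_eq0 ->|x0] := eqVneq (eucl_norm x) 0.
  by rewrite eucl_norm0 mul0r big1// => i _; rewrite mxE mul0r.
have [/eucl_norm_eq0 ->|y0] := eqVneq (eucl_norm y) 0.
  by rewrite eucl_norm0 mulr0 big1// => i _; rewrite mxE mulr0.
set s := eucl_norm x in x0 *; set t := eucl_norm y in y0 *.
have st0 : 0 < s * t.
  by rewrite mulr_gt0// lt_neqAle eucl_norm_ge0 eq_sym ?x0 ?y0.
rewrite -(ler_pM2l st0).
have : 0 <= \sum_(i < d) (t * x ord0 i - s * y ord0 i) ^+ 2.
  by apply: sumr_ge0 => i _; rewrite sqr_ge0.
have -> : \sum_(i < d) (t * x ord0 i - s * y ord0 i) ^+ 2 =
    t ^+ 2 * s ^+ 2 + s ^+ 2 * t ^+ 2 -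
    (s * t) * (\sum_(i < d) x ord0 i * y ord0 i) *+ 2.
  under eq_bigr do rewrite sqrrB !exprMn.
  rewrite !big_split/= -!mulr_sumr -!sqr_eucl_norm -/s -/t sumrN.
  rewrite !big_split/=.
  have -> : \sum_(i < d) t * x ord0 i * (s * y ord0 i) =
      s * t * \sum_(i < d) x ord0 i * y ord0 i.
    by rewrite mulr_sumr; apply: eq_bigr => i _; ring.
  by ring.
by move=> ?; nra.
Qed.

Lemma eucl_normD x y : eucl_norm (x + y) <= eucl_norm x + eucl_norm y.
Proof.
rewrite -ler_sqr ?nnegrE ?addr_ge0 ?eucl_norm_ge0// sqrrD !sqr_eucl_norm.
under eq_bigr do rewrite mxE sqrrD.
rewrite !big_split/= lerD2r lerD2l -mulr2n lerMn2r/=.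
exact: eucl_cauchy_schwarz.
Qed.

End euclidean_norm.

(* An alias, because the library gives 'rV[R]_d itself the sup norm. *)
Definition euclidean (R : realType) (d : nat) : Type := 'rV[R]_d.

Section euclidean_metric.
Context {R : realType} {d : nat}.

HB.instance Definition _ := Choice.copy (euclidean R d) 'rV[R]_d.

Let dist (x y : euclidean R d) : R := eucl_norm (x - y : 'rV[R]_d).

Let distxx x : dist x x = 0.
Proof. by rewrite /dist subrr eucl_norm0. Qed.

Let dist_positivity x y : dist x y = 0 -> x = y.
Proof. by move/eucl_norm_eq0/eqP; rewrite subr_eq0 => /eqP. Qed.

Let dist_sym x y : dist x y = dist y x.
Proof. by rewrite /dist -eucl_normN opprB. Qed.

Let dist_triangle y x z : dist x z <= dist x y + dist y z.
Proof.
rewrite /dist; apply: le_trans (eucl_normD _ _).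
by rewrite addrA subrK.
Qed.

HB.instance Definition _ := @isMetric.Build R (euclidean R d) dist
  distxx dist_positivity dist_sym dist_triangle.

Lemma mdist_euclideanE (x y : euclidean R d) :
  mdist x y = eucl_norm (x - y : 'rV[R]_d).
Proof. by []. Qed.

End euclidean_metric.

Section metric_variation.
Context {R : realType} {X : metricType R}.
Implicit Types (a b : R) (g : R -> X) (f : X -> R).

(* As in the library's variation, which is the case X = R^o, the points of the
   partition are a :: s, and only the values of g on [a, b] matter. *)
Definition mvariation a b g (s : seq R) : R :=
  \sum_(0 <= i < size s)
    mdist (g (nth b (a :: s) i)) (g (nth b (a :: s) i.+1)).

Definition total_mvariation a b g : \bar R :=
  ereal_sup [set (mvariation a b g s)%:E | s in itv_partition a b].

(* The supremum is -oo, not 0, when X has at most one point. *)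
Definition lip_const f : \bar R :=
  ereal_sup [set (`|f p.1 - f p.2| / mdist p.1 p.2)%:E |
    p in [set p : X * X | p.1 != p.2]].

End metric_variation.

Lemma total_mvariationE (R : realType) (a b : R) (f : R -> R) :
  total_mvariation (X := R^o) a b f = total_variation a b f.
Proof.
congr ereal_sup; apply/seteqP; split => z /=.
- by move=> [s abs <-]; exists (variation a b f s) => //; exists s.
- by move=> [x [s abs sx] <-]; exists s => //; rewrite -sx.
Qed.

Section lcj.
Context {R : realType}.

Definition lip_variation (X : metricType R) (a b : R) (g : R -> X) : \bar R :=
  ereal_sup [set total_mvariation (X := R^o) a b (f \o g) |
    f in [set f : X -> R | (lip_const f <= 1)%E]].

Definition LCJ (X : metricType R) (a b : R) : \bar R :=
  ereal_inf [set (lip_variation a b g / total_mvariation a b g)%E |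
    g in [set g : R -> X | (0 < total_mvariation a b g < +oo)%E]].

End lcj.
Arguments LCJ {R} X a b.

(* Main.v *)
(* On the grid {0, .., 2n-1}^d the pairs of points that differ by exactly n in
   every coordinate are at distance n sqrt d, whereas a 1-Lipschitz function
   deviates from its mean only by O(n) on average. A step curve that jumps
   through all these pairs, one after the other, thus has ratio O(d^(-1/2)).

   For the deviation, replace f by its average g over a cube of side m. If m is
   polynomially large in d, then g is nearly affine at unit scale, so that the
   Lipschitz condition bounds the Euclidean norm of its discrete gradient by a
   constant; and the tensorized Poincare inequality on the grid turns this into
   a variance of order n^2. If 2n >= m d, then |f - g| <= 2n. *)
Require Import Defs.
From HB Require Import structures.
From mathcomp Require Import all_boot all_order all_algebra.
From mathcomp Require Import ring lra.
From mathcomp Require Import all_classical all_reals all_analysis.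

Set Implicit Arguments.
Unset Strict Implicit.
Unset Printing Implicit Defensive.

Import Order.TTheory GRing.Theory Num.Theory.
Import numFieldNormedType.Exports.

Local Open Scope ring_scope.

(** * Averages over boxes and a discrete Poincare inequality *)

Section averages.
Context {R : realType} {V : zmodType}.
Implicit Types (n : nat) (c B : R) (u v x : V) (s p : seq V) (h k g : V -> R).

Definition diff v h x : R := h (x + v) - h x.

Definition avg n v h x : R := n%:R^-1 * \sum_(0 <= t < n) h (x + v *+ t).

(** The mean over the box at [x] with [n] points along each direction of [s]; folding one direction
    at a time turns its properties into inductions on [s]. *)
Definition mavg n s h : V -> R := foldr (avg n) h s.

Lemma avg_le n v h k : (forall x, h x <= k x) ->
  forall x, avg n v h x <= avg n v k x.
Proof.
by move=> hk x; rewrite ler_wpM2l ?invr_ge0// ler_sum.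
Qed.

Lemma mavg_le n s h k : (forall x, h x <= k x) ->
  forall x, mavg n s h x <= mavg n s k x.
Proof. by move=> hk; elim: s => //= v s IH x; exact: avg_le. Qed.

Lemma mavg_lin n s c h k :
  mavg n s (fun x => c * h x + k x) =
  (fun x => c * mavg n s h x + mavg n s k x).
Proof.
elim: s => //= v s ->; apply/funext => x.
rewrite /avg mulrCA -mulrDr; congr (_ * _).
by rewrite mulr_sumr -big_split.
Qed.

Lemma mavg_cst n s c x : (0 < n)%N -> mavg n s (fun=> c) x = c.
Proof.
move=> n0; elim: s x => //= v s IH x.
rewrite /avg; under eq_bigr do rewrite IH.
by rewrite sumr_const_nat subn0 -[c *+ n]mulr_natl mulKf// pnatr_eq0 -lt0n.
Qed.

Lemma mavgN n s h : mavg n s (fun x => - h x) = (fun x => - mavg n s h x).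
Proof.
elim: s => //= v s ->; apply/funext => x.
by rewrite /avg sumrN mulrN.
Qed.

Lemma mavgZ n s c h :
  mavg n s (fun x => c * h x) = (fun x => c * mavg n s h x).
Proof.
elim: s => //= v s ->; apply/funext => x.
by rewrite /avg -mulr_sumr mulrCA.
Qed.

Lemma mavg_sum n s (p : seq V) (h : V -> V -> R) x :
  mavg n s (fun x => \sum_(v <- p) h v x) x = \sum_(v <- p) mavg n s (h v) x.
Proof.
elim: p x => [x|v p IH x].
  rewrite big_nil; transitivity (mavg n s (fun x => 0 * 0) x).
    by congr mavg; apply/funext => y; rewrite big_nil mulr0.
  by rewrite (mavgZ _ _ 0 (fun=> 0)) mul0r.
rewrite big_cons -IH.
transitivity (mavg n s (fun x => 1 * h v x + \sum_(w <- p) h w x) x).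
  by congr mavg; apply/funext => y; rewrite big_cons mul1r.
by rewrite mavg_lin mul1r.
Qed.

Lemma mavg_translate n s v h :
  mavg n s (fun x => h (x + v)) = (fun x => mavg n s h (x + v)).
Proof.
elim: s => //= u s ->; apply/funext => x.
by rewrite /avg; congr (_ * _); apply: eq_bigr => t _; rewrite addrAC.
Qed.

Lemma mavg_diff n s v h : mavg n s (diff v h) = diff v (mavg n s h).
Proof.
transitivity (mavg n s (fun x => -1 * h x + h (x + v))).
  by congr mavg; apply/funext => x; rewrite mulN1r addrC.
by rewrite mavg_lin mavg_translate; apply/funext => x; rewrite mulN1r addrC.
Qed.

Lemma mavg_norm_le n s B h : (0 < n)%N -> (forall x, `|h x| <= B) ->
  forall x, `|mavg n s h x| <= B.
Proof.
move=> n0 hB x; rewrite ler_norml; apply/andP; split.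
  rewrite -(mavg_cst s (- B) x n0); apply: mavg_le => y.
  by have := hB y; rewrite ler_norml => /andP[].
rewrite -[leRHS](mavg_cst s B x n0); apply: mavg_le => y.
by have := hB y; rewrite ler_norml => /andP[].
Qed.

(** The mean of the squared deviations from the mean is nonnegative. *)
Lemma sqr_mavg_le n s h x : (0 < n)%N ->
  mavg n s h x ^+ 2 <= mavg n s (fun x => h x ^+ 2) x.
Proof.
move=> n0; set c := mavg n s h x.
have : 0 <= mavg n s (fun y => (h y - c) ^+ 2) x.
  rewrite -(mavg_cst s 0 x n0); apply: mavg_le => y; exact: sqr_ge0.
have -> : (fun y => (h y - c) ^+ 2) =
    fun y => - 2 * c * h y + (1 * h y ^+ 2 + c ^+ 2).
  by apply/funext => y; ring.
rewrite !mavg_lin mavg_cst// -/c; lra.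
Qed.

(* For [v] in [s] the averaged differences telescope along [v]. *)
Lemma diff_mavg_le n s v B h : (0 < n)%N ->
    (forall x, `|h x| <= B) -> v \in s ->
  forall x, `|diff v (mavg n s h) x| <= 2 * B / n%:R.
Proof.
move=> n0 hB; elim: s => //= u s IH; rewrite in_cons.
have [<- _ x|uv /= vs x] := eqVneq v u; last first.
  have -> : diff v (avg n u (mavg n s h)) = avg n u (diff v (mavg n s h)).
    exact: esym (mavg_diff n [:: u] v _).
  by apply: (mavg_norm_le [:: u]) => //; exact: IH.
set k := mavg n s h.
have -> : diff v (avg n v k) x = n%:R^-1 * (k (x + v *+ n) - k (x + v *+ 0)).
  rewrite /diff /avg -mulrBr -sumrB; congr (_ * _).
  rewrite -(telescope_sumr (fun t => k (x + v *+ t)))//.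
  by apply: eq_bigr => t _; rewrite mulrS addrA.
rewrite normrM ger0_norm ?invr_ge0// mulrC ler_wpM2r ?invr_ge0//.
have kB := mavg_norm_le s n0 hB.
by rewrite (le_trans (ler_normB _ _))// mulr2n mulrDl !mul1r lerD// kB.
Qed.

(** The variance is at most the mean square deviation from the value at [x], and each such deviation
    is a sum of fewer than [n] differences. *)
Lemma avg_poincare n v h x : (0 < n)%N ->
  avg n v (fun y => h y ^+ 2) x - avg n v h x ^+ 2 <=
  n%:R ^+ 2 * avg n v (fun y => diff v h y ^+ 2) x.
Proof.
move=> n0; have n0' : (n%:R : R) != 0 by rewrite pnatr_eq0 -lt0n.
set D := avg n v (fun y => diff v h y ^+ 2) x.
have nD : n%:R * D = \sum_(0 <= t < n) diff v h (x + v *+ t) ^+ 2.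
  by rewrite /D /avg mulVKf.
have step t : (t < n)%N -> (h (x + v *+ t) - h x) ^+ 2 <= n%:R ^+ 2 * D.
  move=> tn.
  have -> : h (x + v *+ t) - h x = \sum_(0 <= r < t) diff v h (x + v *+ r).
    have {2}-> : x = x + v *+ 0 by rewrite mulr0n addr0.
    rewrite -(telescope_sumr (fun t => h (x + v *+ t)))//.
    by apply: eq_bigr => r _; rewrite /diff mulrSr addrA.
  have [->|t0] := posnP t.
    rewrite big_geq// expr0n/= mulr_ge0 ?sqr_ge0//.
    rewrite mulr_ge0 ?invr_ge0// sumr_ge0// => *; exact: sqr_ge0.
  have t0' : (t%:R : R) != 0 by rewrite pnatr_eq0 -lt0n.
  (* Cauchy-Schwarz for the [t] differences, read as a bound on the square of their mean. *)
  have := sqr_mavg_le [:: v] (diff v h) x t0; rewrite /= /avg.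
  rewrite exprMn expr2 -mulrA ler_pM2l ?invr_gt0 ?ltr0n//.
  rewrite ler_pdivrMl ?ltr0n// => /le_trans; apply.
  rewrite expr2 -mulrA nD; apply: ler_pM => //.
  - by rewrite sumr_ge0// => *; exact: sqr_ge0.
  - by rewrite ler_nat ltnW.
  - rewrite (big_cat_nat _ (n := t) (p := n))//=; last exact: ltnW.
    by rewrite lerDl sumr_ge0// => *; exact: sqr_ge0.
have : avg n v (fun y => (h y - h x) ^+ 2) x <= n%:R ^+ 2 * D.
  rewrite /avg ler_pdivrMl ?ltr0n//.
  rewrite (le_trans (y := \sum_(0 <= t < n) n%:R ^+ 2 * D))//.
    by rewrite ler_sum_nat// => t /andP[_]; exact: step.
  by rewrite sumr_const_nat subn0 -[leLHS]mulr_natl.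
have -> : (fun y => (h y - h x) ^+ 2) =
    fun y => - 2 * h x * h y + (1 * h y ^+ 2 + h x ^+ 2).
  by apply/funext => y; ring.
have /= -> := mavg_lin n [:: v] (- 2 * h x) h _.
have /= -> := mavg_lin n [:: v] 1 (fun y => h y ^+ 2) _.
have /= -> := mavg_cst [:: v] (h x ^+ 2) x n0.
have := sqr_ge0 (avg n v h x - h x); nra.
Qed.

(** Tensorization: the variance is the mean along [u] of the variances over [s], plus the variance
    along [u] of the means over [s]. In the second term differences commute with averages, so the
    square can be moved inside the mean. *)
Lemma mavg_poincare n s h x : (0 < n)%N ->
  mavg n s (fun y => h y ^+ 2) x - mavg n s h x ^+ 2 <=
  n%:R ^+ 2 * \sum_(v <- s) mavg n s (fun y => diff v h y ^+ 2) x.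
Proof.
move=> n0; elim: s x => [|u s IH] x /=; first by rewrite big_nil mulr0 subrr.
rewrite big_cons mulrDr.
have {}IH : avg n u (mavg n s (fun y => h y ^+ 2)) x -
    avg n u (fun y => mavg n s h y ^+ 2) x <=
    n%:R ^+ 2 * \sum_(v <- s) avg n u (mavg n s (fun y => diff v h y ^+ 2)) x.
  have := avg_le n u IH x.
  have -> : avg n u (fun y => mavg n s (fun y => h y ^+ 2) y -
      mavg n s h y ^+ 2) x =
      avg n u (mavg n s (fun y => h y ^+ 2)) x -
      avg n u (fun y => mavg n s h y ^+ 2) x.
    by rewrite /avg sumrB mulrBr.
  have /= -> := mavgZ n [:: u] (n%:R ^+ 2)
    (fun y => \sum_(v <- s) mavg n s (fun y => diff v h y ^+ 2) y).
  by have /= -> := mavg_sum n [:: u] s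
    (fun v => mavg n s (fun y => diff v h y ^+ 2)) x.
have := avg_poincare u (mavg n s h) x n0.
rewrite -mavg_diff => H1.
have : avg n u (fun y => mavg n s (diff u h) y ^+ 2) x <=
    avg n u (mavg n s (fun y => diff u h y ^+ 2)) x.
  by apply: avg_le => y; exact: sqr_mavg_le.
move=> /(ler_wpM2l (sqr_ge0 (n%:R : R))); lra.
Qed.

(** Each step of the path changes every later difference by at most [K]; this bounds the loss when
    all differences are taken at the starting point. *)
Lemma path_sum_le s g K p x : 0 <= K ->
  (forall u v, u \in s -> v \in s -> forall y, `|diff u (diff v g) y| <= K) ->
  {subset p <= s} ->
  \sum_(v <- p) diff v g x - K * (size p)%:R ^+ 2 <=
  g (x + \sum_(v <- p) v) - g x.
Proof.
move=> K0 gK; elim: p x => [|u p IH] x ps.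
  by rewrite !big_nil addr0 expr0n mulr0 !subrr.
have us : u \in s by apply: ps; rewrite mem_head.
have {}ps : {subset p <= s} by move=> v vp; apply: ps; rewrite in_cons vp orbT.
rewrite !big_cons /= addrA -natr1.
have := IH (x + u) ps.
have : \sum_(v <- p) diff v g x - K * (size p)%:R <=
    \sum_(v <- p) diff v g (x + u).
  rewrite lerBlDr.
  have -> : K * (size p)%:R = \sum_(v <- p) K.
    by rewrite big_const_seq count_predT iter_addr_0 mulr_natr.
  rewrite -big_split/= big_seq [leRHS]big_seq; apply: ler_sum => v /ps vs.
  by have := gK _ _ us vs x; rewrite ler_norml {1}/diff => /andP[]; lra.
rewrite [in X in _ -> _ -> X]/diff.
have : 0 <= K * (size p)%:R by rewrite mulr_ge0.
nra.
Qed.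

End averages.

(** * Gradient and deviation bounds for Lipschitz functions *)

Section euclidean_basis.
Context {R : realType} {d : nat}.
Implicit Types (f : 'rV[R]_d -> R) (x y : 'rV[R]_d) (m n : nat).

(** Stated on ['rV[R]_d], whose additive structure the averages need. *)
Definition lip1 f := forall x y, `|f x - f y| <= eucl_norm (x - y).

Definition std_basis : seq 'rV[R]_d := [seq delta_mx ord0 i | i : 'I_d].

Lemma big_std_basis (F : 'rV[R]_d -> R) :
  \sum_(v <- std_basis) F v = \sum_(i < d) F (delta_mx ord0 i).
Proof. by rewrite /std_basis big_image. Qed.

Lemma eucl_norm_delta i : eucl_norm (delta_mx ord0 i : 'rV[R]_d) = 1.
Proof.
rewrite /eucl_norm (bigD1 i)//= big1 ?mxE ?eqxx ?expr1n ?addr0 ?sqrtr1//.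
by move=> j ji; rewrite mxE eqxx (negbTE ji) expr0n.
Qed.

Lemma lip1_mavg_diff m f x y : (0 < m)%N -> lip1 f ->
  `|diff y (mavg m std_basis f) x| <= eucl_norm y.
Proof.
move=> m0 lf; rewrite -mavg_diff; apply: mavg_norm_le => // z.
by rewrite /diff (le_trans (lf _ _))// addrC addrA addNr add0r.
Qed.

(* The second differences of the average of [f] are at most [2 / m]; hence
   moving by [w], the integral part of [d] times the positive part of the
   gradient, raises it by nearly [d] times the sum of squares, while the
   Lipschitz condition bounds the increase by the norm of [w]. *)
Lemma sum_sqr_diff_pos_le m f x : (0 < d)%N -> (2 * d ^ 3 <= m)%N -> lip1 f ->
  \sum_(v <- std_basis) Num.max (diff v (mavg m std_basis f) x) 0 ^+ 2 <= 4.
Proof.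
move=> d0 md lf; rewrite big_std_basis.
have m0 : (0 < m)%N by apply: leq_trans md; rewrite muln_gt0 expn_gt0 d0.
have d0' : (0 : R) < d%:R by rewrite ltr0n.
set g := mavg m std_basis f.
pose D i := diff (delta_mx ord0 i : 'rV[R]_d) g x.
pose P i := Num.max (D i) 0.
rewrite -[leLHS]/(\sum_i P i ^+ 2).
have D1 i : `|D i| <= 1.
  by rewrite -(eucl_norm_delta i); exact: lip1_mavg_diff.
have P0 i : 0 <= P i by rewrite /P le_max lexx orbT.
have P1 i : P i <= 1.
  by rewrite /P ge_max ler01 andbT (le_trans (ler_norm _)).
pose w i := Num.truncn (d%:R * P i).
have w_le i : (w i)%:R <= d%:R * P i by rewrite truncn_le mulr_ge0.
have w_gt i : d%:R * P i < (w i)%:R + 1 by rewrite natr1 truncnS_gt.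
(* Where [D i] is negative, [w i] is 0, so the gradient may be replaced by its positive part. *)
have wD i : (w i)%:R * D i = (w i)%:R * P i.
  rewrite /w /P; case: (leP (D i) 0) => // _.
  by rewrite mulr0 truncn0 !mul0r.
(* A lattice path to the point [w]; it has at most [d ^ 2] steps because [P i <= 1]. *)
pose p := flatten [seq nseq (w i) (delta_mx ord0 i : 'rV[R]_d) | i : 'I_d].
have pE (T : nmodType) (F : 'rV[R]_d -> T) :
    \sum_(v <- p) F v = \sum_i F (delta_mx ord0 i) *+ w i.
  rewrite /p big_flatten big_image; apply: eq_bigr => i _.
  by rewrite big_nseq iter_addr_0.
have pb : {subset p <= std_basis}.
  move=> v /flattenP[q /mapP[i _ ->]]; rewrite mem_nseq => /andP[_ /eqP ->].
  by apply/mapP; exists i; rewrite ?mem_enum.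
have sp : (size p)%:R <= (d%:R ^+ 2 : R).
  have -> : (size p)%:R = \sum_i (w i)%:R :> R.
    rewrite -sum1_size natr_sum pE; apply: eq_bigr => i _; by [].
  apply: (le_trans (y := \sum_(i < d) d%:R)).
    by apply: ler_sum => i _; rewrite (le_trans (w_le i))// ler_piMr.
  by rewrite sumr_const card_ord expr2 mulr_natr.
set z := \sum_(v <- p) v.
have zE i : z ord0 i = (w i)%:R.
  rewrite /z pE summxE (bigD1 i)//= big1; last first.
    by move=> j ji; rewrite mulmxnE mxE eqxx eq_sym (negbTE ji) mul0rn.
  by rewrite mulmxnE mxE !eqxx addr0.
have S0 : 0 <= \sum_i P i ^+ 2 by rewrite sumr_ge0// => i _; exact: sqr_ge0.
have zS : eucl_norm z <= d%:R * Num.sqrt (\sum_i P i ^+ 2).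
  rewrite -ler_sqr ?nnegrE ?mulr_ge0 ?eucl_norm_ge0 ?sqrtr_ge0//.
  rewrite sqr_eucl_norm exprMn sqr_sqrtr// mulr_sumr.
  apply: ler_sum => i _; rewrite zE -exprMn ler_sqr ?nnegrE ?mulr_ge0//.
have K0 : 0 <= 2 * 1 / m%:R :> R by rewrite divr_ge0 ?mulr1.
have gK u v : u \in std_basis -> v \in std_basis ->
    forall y, `|diff u (diff v g) y| <= 2 * 1 / m%:R.
  move=> ub /mapP[i _ ->] y; rewrite -mavg_diff.
  apply: diff_mavg_le => // y'; rewrite -(eucl_norm_delta i).
  by rewrite /diff (le_trans (lf _ _))// addrC addrA addNr add0r.
have := path_sum_le x K0 gK pb.
have : g (x + z) - g x <= eucl_norm z.
  by rewrite (le_trans (ler_norm _))// lip1_mavg_diff.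
have -> : \sum_(v <- p) diff v g x = \sum_i (w i)%:R * P i.
  by rewrite pE; apply: eq_bigr => i _; rewrite -wD mulr_natl.
(* Rounding costs at most [P i <= 1] in each coordinate. *)
have : d%:R * \sum_i P i ^+ 2 - d%:R <= \sum_i (w i)%:R * P i.
  have -> : d%:R = \sum_(i < d) (1 : R) by rewrite sumr_const card_ord.
  rewrite {1}sumr_const card_ord mulr_sumr -sumrB; apply: ler_sum => i _.
  have := w_gt i; have := P0 i; have := P1 i; nra.
(* The drift of the differences costs at most [2 * d ^ 4 / m], hence at most [d] by the choice of
   [m]. *)
have : 2 * 1 / m%:R * (size p)%:R ^+ 2 <= (d%:R : R).
  rewrite mulr1 mulrAC ler_pdivrMr ?ltr0n//.
  have : (2 * d ^ 3)%:R <= (m%:R : R) by rewrite ler_nat.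
  rewrite natrM natrX => /(ler_wpM2l (ltW d0')); apply: le_trans.
  rewrite [leRHS]mulrCA -exprS ler_pM2l// (_ : 4 = 2 * 2)%N// exprM.
  by rewrite ler_sqr ?nnegrE ?exprn_ge0.
move=> H1 H2 H3 H4.
(* The root [r] of the sum satisfies [r ^ 2 <= r + 2], which forces [r <= 2]. *)
have {H1 H2 H3 H4} : d%:R * (\sum_i P i ^+ 2) <=
    d%:R * (Num.sqrt (\sum_i P i ^+ 2) + 2) by lra.
rewrite ler_pM2l//.
have := sqr_sqrtr S0; have := sqrtr_ge0 (\sum_i P i ^+ 2); nra.
Qed.

Lemma lip1N f : lip1 f -> lip1 (fun x => - f x).
Proof. by move=> lf x y; rewrite -opprD normrN; exact: lf. Qed.

(** The negative part of the gradient of [f] is the positive part of that of [- f], so each part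
    contributes 4. *)
Lemma sum_sqr_diff_le m f x : (0 < d)%N -> (2 * d ^ 3 <= m)%N -> lip1 f ->
  \sum_(v <- std_basis) diff v (mavg m std_basis f) x ^+ 2 <= 8.
Proof.
move=> d0 md lf.
have := sum_sqr_diff_pos_le x d0 md lf.
have := sum_sqr_diff_pos_le x d0 md (lip1N lf).
rewrite mavgN => H1 H2; have -> : 8 = 4 + 4 :> R by lra.
apply: le_trans (lerD H1 H2); rewrite -big_split/=.
apply: ler_sum => v _; set D := diff v (mavg m std_basis f) x.
have -> : diff v (fun y => - mavg m std_basis f y) x = - D.
  by rewrite /D /diff opprD.
case: (leP D 0) => D0; case: (leP (- D) 0) => D0'; nra.
Qed.

Lemma eucl_normMn x n : eucl_norm (x *+ n) <= n%:R * eucl_norm x.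
Proof.
elim: n => [|n IH]; first by rewrite mulr0n eucl_norm0 mul0r.
by rewrite mulrS (le_trans (eucl_normD _ _))// -nat1r mulrDl mul1r lerD2l.
Qed.

(** Every averaged point lies within the stated distance of [x]. *)
Lemma mavg_near m s f x : (0 < m)%N -> lip1 f ->
  `|mavg m s f x - f x| <= m%:R * \sum_(v <- s) eucl_norm v.
Proof.
move=> m0 lf; elim: s x => [|v s IH] x /=.
  by rewrite subrr normr0 big_nil mulr0.
have m0' : (0 : R) < m%:R by rewrite ltr0n.
have -> : avg m v (mavg m s f) x - f x =
    m%:R^-1 * \sum_(0 <= t < m) (mavg m s f (x + v *+ t) - f x).
  rewrite sumrB sumr_const_nat subn0 -[f x *+ m]mulr_natl mulrBr.
  by rewrite mulKf// gt_eqF.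
rewrite normrM ger0_norm ?invr_ge0// ler_pdivrMl//.
rewrite (le_trans (ler_norm_sum _ _ _))// big_cons.
set S := \sum_(v <- s) _.
apply: (le_trans (y := \sum_(0 <= t < m) (m%:R * (eucl_norm v + S)))).
  apply: ler_sum_nat => t /andP[_ tm].
  have -> : mavg m s f (x + v *+ t) - f x =
      (f (x + v *+ t) - f x) + (mavg m s f (x + v *+ t) - f (x + v *+ t)).
    ring.
  rewrite (le_trans (ler_normD _ _))// mulrDr lerD//.
  rewrite (le_trans (lf _ _))// addrC addKr (le_trans (eucl_normMn _ _))//.
  by rewrite ler_wpM2r ?eucl_norm_ge0// ler_nat ltnW.
by rewrite sumr_const_nat subn0 -[leLHS]mulr_natl.
Qed.

(* Since [m * d <= n], the smoothing at scale [m] moves [f] by at most [n]. *)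
Lemma mavg_lip1_deviation n m f : (0 < d)%N -> (2 * d ^ 3 <= m)%N ->
  (m * d <= n)%N -> lip1 f ->
  exists c, mavg n std_basis (fun x => `|f x - c|) 0 <= 4 * n%:R.
Proof.
move=> d0 md mn lf.
have m0 : (0 < m)%N by apply: leq_trans md; rewrite muln_gt0 expn_gt0 d0.
have n0 : (0 < n)%N by apply: leq_trans mn; rewrite muln_gt0 m0.
have n0' : (0 : R) < n%:R by rewrite ltr0n.
set g := mavg m std_basis f; pose c := mavg n std_basis g 0; exists c.
set E := mavg n std_basis (fun x => `|g x - c|) 0.
(* The Poincare inequality with gradient bound 8 controls the second moment, and [8 <= 3 ^ 2]. *)
have E3 : E <= 3 * n%:R.
  have : E ^+ 2 <= 8 * n%:R ^+ 2.
    rewrite (le_trans (sqr_mavg_le _ _ _ n0))//.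
    have -> : (fun y => `|g y - c| ^+ 2) =
        fun y => - 2 * c * g y + (1 * g y ^+ 2 + c ^+ 2).
      by apply/funext => y; rewrite real_normK ?num_real//; ring.
    rewrite !mavg_lin mavg_cst// -/c.
    have := mavg_poincare std_basis g 0 n0; rewrite -/c -mavg_sum.
    have : mavg n std_basis
        (fun x => \sum_(v <- std_basis) diff v g x ^+ 2) 0 <= 8.
      rewrite -[leRHS](mavg_cst std_basis 8 0 n0); apply: mavg_le => y.
      exact: sum_sqr_diff_le.
    move=> /(ler_wpM2l (sqr_ge0 (n%:R : R))); lra.
  have : 0 <= E by rewrite -(mavg_cst std_basis 0 0 n0); exact: mavg_le.
  nra.
apply: (le_trans (y := mavg n std_basis (fun x => 1 * `|g x - c| + n%:R) 0)).
  apply: mavg_le => y; rewrite mul1r [leRHS]addrC.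
  have -> : f y - c = (f y - g y) + (g y - c) by ring.
  rewrite (le_trans (ler_normD _ _))// lerD2r distrC.
  rewrite (le_trans (mavg_near _ _ m0 lf))// big_std_basis.
  under eq_bigr do rewrite eucl_norm_delta.
  by rewrite sumr_const card_ord -natrM ler_nat.
by rewrite mavg_lin mul1r mavg_cst// -/E; lra.
Qed.

End euclidean_basis.

(** * Antipodal pairs of grid points *)

Section antipodes.
Context {R : realType} {V : zmodType}.
Implicit Types (n : nat) (x y v : V) (s : seq V) (h : V -> R).

(** Both orders are listed so that each component takes every value below [2 * n] exactly once. *)
Definition half_shifts n : seq (nat * nat) :=
  [seq (t, n + t)%N | t <- iota 0 n] ++ [seq (n + t, t)%N | t <- iota 0 n].

(** The endpoints [x] and [y] are accumulated separately; each direction of [s] independently shifts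
    them apart by [n], with either sign. *)
Fixpoint antipodes n s x y : seq (V * V) :=
  if s is v :: s' then
    flatten [seq antipodes n s' (x + v *+ t.1) (y + v *+ t.2)
            | t <- half_shifts n]
  else [:: (x, y)].

Lemma sum_half_shifts_fst n (F : nat -> R) :
  \sum_(t <- half_shifts n) F t.1 = \sum_(0 <= t < 2 * n) F t.
Proof.
rewrite /half_shifts big_cat !big_map/= mul2n -addnn.
rewrite (big_cat_nat _ (n := n))//= ?leq_addr//; congr (_ + _).
  by rewrite /index_iota subn0.
rewrite -{3}(add0n n) big_addn addnK /index_iota subn0.
by apply: eq_bigr => t _; rewrite addnC.
Qed.

Lemma sum_half_shifts_snd n (F : nat -> R) :
  \sum_(t <- half_shifts n) F t.2 = \sum_(0 <= t < 2 * n) F t.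
Proof.
rewrite -sum_half_shifts_fst /half_shifts !big_cat !big_map/=.
by rewrite addrC.
Qed.

(** Each choice of shifts in the box of side [2 * n] occurs once as a first component, so sums over
    pairs become grid means. *)
Lemma sum_antipodes_fst n s x y h : (0 < n)%N ->
  \sum_(p <- antipodes n s x y) h p.1 =
  (2 * n)%:R ^+ size s * mavg (2 * n) s h x.
Proof.
move=> n0; elim: s x y => [|v s IH] x y /=; first by rewrite big_seq1 mul1r.
rewrite big_flatten big_map/=; under eq_bigr do rewrite IH.
rewrite (sum_half_shifts_fst n (fun t => _ * mavg _ s h (x + v *+ t))).
rewrite -mulr_sumr /avg exprS mulrACA mulfV ?mul1r//.
by rewrite pnatr_eq0 -lt0n muln_gt0.
Qed.

Lemma sum_antipodes_snd n s x y h : (0 < n)%N ->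
  \sum_(p <- antipodes n s x y) h p.2 =
  (2 * n)%:R ^+ size s * mavg (2 * n) s h y.
Proof.
move=> n0; elim: s x y => [|v s IH] x y /=; first by rewrite big_seq1 mul1r.
rewrite big_flatten big_map/=; under eq_bigr do rewrite IH.
rewrite (sum_half_shifts_snd n (fun t => _ * mavg _ s h (y + v *+ t))).
rewrite -mulr_sumr /avg exprS mulrACA mulfV ?mul1r//.
by rewrite pnatr_eq0 -lt0n muln_gt0.
Qed.

Lemma size_antipodes n s x y : (0 < n)%N ->
  size (antipodes n s x y) = ((2 * n) ^ size s)%N.
Proof.
move=> n0; apply/eqP; rewrite -(eqr_nat R) natrX -sum1_size natr_sum.
by rewrite (sum_antipodes_fst s x y (fun=> 1) n0) mavg_cst ?mulr1 ?muln_gt0.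
Qed.

End antipodes.

(** * Distance between antipodes *)

Section antipodes_distance.
Context {R : realType} {d : nat}.
Local Notation e i := (delta_mx ord0 i : 'rV[R]_d).

(** The first clause serves the induction: as [s] has no repetition, the gap created when a
    coordinate has its turn survives the remaining shifts. *)
Lemma antipodes_entry n (s : seq 'I_d) (x y : 'rV[R]_d) p : uniq s ->
  p \in antipodes n [seq e i | i <- s] x y -> forall j,
  (j \notin s -> (p.1 - p.2) ord0 j = (x - y) ord0 j) /\
  (j \in s -> (x - y) ord0 j = 0 -> `|(p.1 - p.2) ord0 j| = n%:R).
Proof.
elim: s x y => [|i s IH] x y /=; first by move=> _; rewrite inE => /eqP -> j.
move=> /andP[nis us] /flattenP[l /mapP[t ts ->]] /(IH _ _ us) {}IH j.
have [IHn IHs] := IH j.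
have shiftE : (x + e i *+ t.1 - (y + e i *+ t.2)) ord0 j =
    (x - y) ord0 j + (i == j)%:R * (t.1%:R - t.2%:R).
  have eE r : (e i *+ r) ord0 j = (i == j)%:R * r%:R.
    by rewrite mulmxnE mxE eqxx/= eq_sym mulr_natr.
  have addE (A B : 'rV[R]_d) : (A + B) ord0 j = A ord0 j + B ord0 j.
    by rewrite mxE.
  have oppE (A : 'rV[R]_d) : (- A) ord0 j = - A ord0 j by rewrite mxE.
  by rewrite !(addE, oppE, eE); ring.
rewrite in_cons; split.
  rewrite negb_or => /andP[ji js].
  by rewrite IHn// shiftE eq_sym (negbTE ji) mul0r addr0.
have [ji _ xy0|ji /= js xy0] := eqVneq j i.
  rewrite IHn; last by rewrite ji.
  rewrite shiftE xy0 add0r ji eqxx mul1r.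
  move: ts; rewrite mem_cat => /orP[] /mapP[r _ ->] /=; rewrite natrD.
    by rewrite opprD addrCA subrr addr0 normrN ger0_norm.
  by rewrite addrK ger0_norm.
by rewrite IHs// shiftE xy0 eq_sym (negbTE ji) mul0r addr0.
Qed.

Lemma eucl_norm_antipodes n (x : 'rV[R]_d) p :
  p \in antipodes n std_basis x x ->
  eucl_norm (p.1 - p.2) = n%:R * Num.sqrt (d%:R : R).
Proof.
move=> pa; apply/eqP.
rewrite -(@eqrXn2 _ 2) ?mulr_ge0 ?eucl_norm_ge0 ?sqrtr_ge0//.
rewrite sqr_eucl_norm exprMn sqr_sqrtr//; apply/eqP.
transitivity (\sum_(i < d) (n%:R ^+ 2 : R)); last first.
  by rewrite sumr_const card_ord mulr_natr.
apply: eq_bigr => i _; rewrite -(real_normK (num_real _)).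
have [_ ->//] := antipodes_entry (enum_uniq 'I_d) pa i.
  by rewrite mem_enum.
by rewrite subrr mxE.
Qed.

End antipodes_distance.

(** * Step curves through a finite chain of points *)

Section step_curve.
Context {R : realType}.
Implicit Types (a b : R) (L : nat).

Lemma mdist_chain_le (X : metricType R) (q : nat -> X) (i j : nat) :
  (i <= j)%N ->
  mdist (q i) (q j) <= \sum_(i <= k < j) mdist (q k) (q k.+1).
Proof.
elim: j => [|j IH]; first by rewrite leqn0 => /eqP ->; rewrite mdistxx big_geq.
rewrite leq_eqVlt => /predU1P[->|ij]; first by rewrite mdistxx big_geq.
rewrite big_nat_recr//= (le_trans (metric_triangle _ (q j) _))// lerD2r.
exact: IH.
Qed.

(** Equal to [k] on the [k]-th of [L] half-open subintervals and to [L] only at [b]: the curve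
    [q \o step_time a b L] visits [q 0] to [q L] in [L] jumps. *)
Definition step_time a b L (t : R) : nat :=
  Num.truncn (L%:R * ((t - a) / (b - a))).

Lemma step_time_le a b L s t : a < b -> s <= t ->
  (step_time a b L s <= step_time a b L t)%N.
Proof.
move=> ab st; apply: le_truncn; rewrite ler_wpM2l// ler_wpM2r//.
  by rewrite invr_ge0 subr_ge0 ltW.
by rewrite lerB.
Qed.

Lemma step_timel a b L : step_time a b L a = 0%N.
Proof. by rewrite /step_time subrr mul0r mulr0 truncn0. Qed.

Lemma step_timer a b L : a < b -> step_time a b L b = L.
Proof.
by move=> ab; rewrite /step_time divff ?mulr1 ?natrK// subr_eq0 gt_eqF.
Qed.

(** A partition cuts the range of [k] into consecutive blocks, and on each block the triangle
    inequality applies. *)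
Lemma mvariation_nondecreasing_le (X : metricType R) a b (q : nat -> X)
    (k : R -> nat) s :
  {homo k : x y / x <= y >-> (x <= y)%N} -> itv_partition a b s ->
  mvariation a b (q \o k) s <= \sum_(k a <= i < k b) mdist (q i) (q i.+1).
Proof.
move=> khomo; rewrite /mvariation.
elim: s a => [|x s IH] a abs.
  by rewrite /= big_geq// sumr_ge0// => i _; exact: mdist_ge0.
rewrite /= big_nat_recl//=.
have [/= /andP[/ltW ax _] _] := abs.
have xbs := itv_partition_cons abs.
rewrite [leRHS](@big_cat_nat _ _ _ (k x))//=; last 2 first.
- exact: khomo.
- exact/khomo/(itv_partition_le xbs).
by apply: lerD; [exact/mdist_chain_le/khomo|exact: IH].
Qed.

Lemma total_mvariation_step_le (X : metricType R) a b L (q : nat -> X) :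
  a < b ->
  (total_mvariation a b (q \o step_time a b L) <=
   (\sum_(0 <= k < L) mdist (q k) (q k.+1))%:E)%E.
Proof.
move=> ab; apply: ge_ereal_sup => _ [s abs <-].
have khomo : {homo step_time a b L : x y / x <= y >-> (x <= y)%N}.
  by move=> x y; exact: step_time_le.
have := mvariation_nondecreasing_le q khomo abs.
by rewrite step_timel step_timer.
Qed.

Lemma total_mvariation_step_ge (X : metricType R) a b L (q : nat -> X) :
  a < b -> (0 < L)%N ->
  ((\sum_(0 <= k < L) mdist (q k) (q k.+1))%:E <=
   total_mvariation a b (q \o step_time a b L))%E.
Proof.
move=> ab L0; apply: le_ereal_sup_tmp.
(* The time at which the curve reaches [q k]; the partition by these times sees every jump. *)
pose u k : R := a + (b - a) * (k%:R / L%:R).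
have L0' : (0 : R) < L%:R by rewrite ltr0n.
have ba0 : 0 < b - a by rewrite subr_gt0.
have uq k : step_time a b L (u k) = k.
  rewrite /step_time; set z := (X in Num.truncn X).
  have -> : z = k%:R by rewrite /z /u; field; rewrite !gt_eqF.
  exact: natrK.
have ult k : u k < u k.+1.
  by rewrite /u ltrD2l ltr_pM2l// ltr_pM2r ?invr_gt0// ltr_nat.
have u0 : u 0%N = a by rewrite /u mul0r mulr0 addr0.
have uL : u L = b by rewrite /u divff ?gt_eqF// mulr1 addrC subrK.
exists (mvariation a b (q \o step_time a b L) [seq u k | k <- iota 1 L])%:E.
  exists [seq u k | k <- iota 1 L] => //; split.
    rewrite -u0; elim: {1}L 0%N => //= l IH k.
    by rewrite ult; exact: IH.
  rewrite -u0 last_map (last_nth 0%N) size_iota.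
  by rewrite -[0%N :: iota 1 L]/(iota 0 L.+1) nth_iota// add0n uL.
have nthE j : (j <= L)%N -> nth b (a :: [seq u k | k <- iota 1 L]) j = u j.
  have -> : a :: [seq u k | k <- iota 1 L] = [seq u k | k <- iota 0 L.+1].
    by rewrite /= u0.
  by move=> jL; rewrite (nth_map 0%N) ?size_iota// nth_iota.
rewrite lee_fin /mvariation size_map size_iota.
by apply: ler_sum_nat => k /andP[_ kL]; rewrite !nthE ?(ltnW kL)//= !uq.
Qed.

Lemma lip_const_le1 (X : metricType R) (f : X -> R) : (lip_const f <= 1)%E ->
  forall x y, `|f x - f y| <= mdist x y.
Proof.
move=> /ereal_supP f1 x y; have [->|xy] := eqVneq x y.
  by rewrite subrr normr0 mdistxx.
have := f1 (`|f x - f y| / mdist x y)%:E; rewrite lee_fin.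
rewrite ler_pdivrMr ?mdist_gt0// mul1r; apply.
by exists (x, y).
Qed.

(** The step curve has variation exactly the length of the chain, and its image under [f] is again a
    step curve. *)
Lemma LCJ_le_chain (X : metricType R) a b (B : R) L (q : nat -> X) :
  a < b -> (0 < L)%N ->
  0 < \sum_(0 <= k < L) mdist (q k) (q k.+1) ->
  (forall f : X -> R, (forall x y, `|f x - f y| <= mdist x y) ->
    \sum_(0 <= k < L) `|f (q k) - f (q k.+1)| <=
    B * \sum_(0 <= k < L) mdist (q k) (q k.+1)) ->
  (LCJ X a b <= B%:E)%E.
Proof.
move=> ab L0; set l := \sum_(0 <= k < L) _ => l0 fB.
pose g := q \o step_time a b L.
have gE : total_mvariation a b g = l%:E.
  apply/eqP; rewrite eq_le total_mvariation_step_le//.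
  exact: total_mvariation_step_ge.
apply: ge_ereal_inf; exists (lip_variation a b g / total_mvariation a b g)%E.
  by exists g => //=; rewrite gE lte_fin l0 ltry.
rewrite gE inver gt_eqF// lee_pdivrMr//; apply: ge_ereal_sup => _ [f /= f1 <-].
apply: (le_trans (total_mvariation_step_le (X := R^o) L (f \o q) ab)).
rewrite -EFinM lee_fin; apply: le_trans (fB f (lip_const_le1 f1)).
by apply: ler_sum => k _; rewrite distrC.
Qed.

End step_curve.

(** * Chains that run through a list of pairs *)

Section chains_of_pairs.
Context {R : realType} {X : metricType R}.
Implicit Types (a b c B : R) (l : seq (X * X)).

Lemma sum_nat_double (G : nat -> R) K :
  \sum_(0 <= k < K.*2) G k = \sum_(0 <= j < K) (G j.*2 + G j.*2.+1).
Proof.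
elim: K => [|K IH]; first by rewrite !big_geq.
by rewrite doubleS !big_nat_recr//= IH addrA.
Qed.

(** Jumps from one pair to the next only lengthen the chain. An increment of [f] is at most the sum
    of the deviations from [c] at its two ends, and each point ends at most two jumps; hence the
    factor 2. *)
Lemma LCJ_le_pairs a b B l : a < b -> 0 <= B ->
  0 < \sum_(p <- l) mdist p.1 p.2 ->
  (forall f : X -> R, (forall x y, `|f x - f y| <= mdist x y) ->
    exists c, 2 * \sum_(p <- l) (`|f p.1 - c| + `|f p.2 - c|) <=
      B * \sum_(p <- l) mdist p.1 p.2) ->
  (LCJ X a b <= B%:E)%E.
Proof.
move=> ab B0; case: l => [|p0 l']; first by rewrite big_nil ltxx.
set l := p0 :: l' => l0 fB.
pose q k := let p := nth p0 l k./2 in if odd k then p.2 else p.1.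
have qe j : q j.*2 = (nth p0 l j).1 by rewrite /q odd_double doubleK.
have qo j : q j.*2.+1 = (nth p0 l j).2.
  by rewrite /q /= odd_double uphalf_double.
(* The [2 * size l] points are joined by one jump fewer. *)
pose L := (size l').*2.+1.
have LE : L.+1 = (size l).*2 by rewrite /= doubleS.
have dist_le : \sum_(p <- l) mdist p.1 p.2 <=
    \sum_(0 <= k < L) mdist (q k) (q k.+1).
  (* Only the jumps inside pairs, which start at even indices, are kept. *)
  pose H k := if odd k then 0 else mdist (q k) (q k.+1).
  have -> : \sum_(p <- l) mdist p.1 p.2 = \sum_(0 <= k < L.+1) H k.
    rewrite LE sum_nat_double (big_nth p0); apply: eq_bigr => j _.
    by rewrite /H/= odd_double/= addr0 qe qo.
  have HL : H L = 0 by rewrite /H/= odd_double.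
  rewrite big_nat_recr//= HL addr0.
  by apply: ler_sum => k _; rewrite /H; case: ifP => // _; exact: mdist_ge0.
apply: (@LCJ_le_chain _ _ _ _ _ L q) => //; first exact: lt_le_trans dist_le.
move=> f lf; have [c fc] := fB f lf.
apply: le_trans (ler_wpM2l B0 dist_le); apply: le_trans fc.
pose F k := `|f (q k) - c|.
have -> : \sum_(p <- l) (`|f p.1 - c| + `|f p.2 - c|) =
    \sum_(0 <= k < L.+1) F k.
  rewrite LE sum_nat_double (big_nth p0); apply: eq_bigr => j _.
  by rewrite /F qe qo.
(* The start points of jumps omit the last point and the end points omit the first; the omitted
   deviations are nonnegative. *)
have Er : \sum_(0 <= k < L.+1) F k = \sum_(0 <= k < L) F k + F L.
  by rewrite big_nat_recr.
have El : \sum_(0 <= k < L.+1) F k = F 0%N + \sum_(0 <= k < L) F k.+1.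
  by rewrite big_nat_recl.
have : \sum_(0 <= k < L) `|f (q k) - f (q k.+1)| <=
    \sum_(0 <= k < L) F k + \sum_(0 <= k < L) F k.+1.
  rewrite -big_split/=; apply: ler_sum => k _.
  by rewrite /F [in leRHS](distrC (f (q k.+1))); exact: ler_distD.
have := normr_ge0 (f (q L) - c); have := normr_ge0 (f (q 0%N) - c).
rewrite -/(F L) -/(F 0%N).
lra.
Qed.

End chains_of_pairs.

(** * Choice of grid size and constants in Euclidean space *)

Theorem theorem1p3 (R : realType) :
  exists C : R, 0 < C /\
    forall (a b : R) (d : nat), a < b -> (1 < d)%N ->
      (LCJ (euclidean R d) a b <=
        (C * d%:R `^ (- (1 / 2)) * (ln d%:R) `^ (1 / 2))%:E)%E.
Proof.
have ln2 : 0 < Num.sqrt (ln 2) :> R by rewrite sqrtr_gt0 ln_gt0// ltr1n.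
(* The argument yields [32 / sqrt d]; as [d >= 2], the factor [sqrt (ln d / ln 2)] is at least 1. *)
exists (32 / Num.sqrt (ln 2)); split; first by rewrite divr_gt0.
move=> a b d ab d1; have d0 : (0 < d)%N by exact: ltnW.
rewrite div1r powRN !powR12_sqrt//; last by rewrite ln_ge0// ler1n.
have sd : 0 < Num.sqrt d%:R :> R by rewrite sqrtr_gt0 ltr0n.
set B := (X in X%:E).
have B32 : 32 <= B * Num.sqrt d%:R.
  rewrite /B mulrAC divfK ?gt_eqF// mulrAC ler_pdivlMr// ler_pM2l//.
  by rewrite ler_wsqrtr// ler_ln ?posrE ?ltr0n// ler_nat.
(* Smoothing at scale [m = 2 * d ^ 3] then gives [m * d = 2 * n], the side of the grid. *)
pose n := (d ^ 4)%N; have n0 : (0 < n)%N by rewrite expn_gt0 d0.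
have n0' : (0 : R) < n%:R by rewrite ltr0n.
pose l := antipodes n (@std_basis R d) 0 0.
have sb : size (@std_basis R d) = d by rewrite size_map -cardE card_ord.
pose K : R := (2 * n)%:R ^+ d.
have K0 : 0 < K by rewrite exprn_gt0// ltr0n muln_gt0.
have lE : \sum_(p <- l) mdist (p.1 : euclidean R d) p.2 =
    K * (n%:R * Num.sqrt d%:R).
  rewrite big_seq.
  under eq_bigr => p pl do rewrite mdist_euclideanE (eucl_norm_antipodes pl).
  rewrite -big_seq big_const_seq count_predT iter_addr_0.
  by rewrite size_antipodes// sb -[RHS]mulrC /K -natrX mulr_natr.
apply: (@LCJ_le_pairs _ (euclidean R d) _ _ _ l) => //.
- by rewrite /B !mulr_ge0 ?invr_ge0 ?sqrtr_ge0.
- by rewrite lE !mulr_gt0.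
move=> f lf; have {}lf : lip1 (f : 'rV[R]_d -> R) by exact: lf.
have mn : (2 * d ^ 3 * d <= 2 * n)%N by rewrite -mulnA -expnSr.
have [c fc] := mavg_lip1_deviation d0 (leqnn _) mn lf.
exists c; rewrite lE big_split/=.
rewrite (sum_antipodes_fst std_basis 0 0 (fun x => `|f x - c|) n0).
rewrite (sum_antipodes_snd std_basis 0 0 (fun x => `|f x - c|) n0) sb -/K.
move: fc; set M := mavg _ _ _ _; rewrite natrM => fc.
have /(ler_wpM2l (ltW K0)) := fc.
(* The mean deviation on the side [2 * n] is at most [8 * n]; two endpoints and the factor 2 for
   chains make 32. *)
have : 32 * (K * n%:R) <= B * Num.sqrt d%:R * (K * n%:R).
  by rewrite ler_wpM2r// mulr_ge0 ?ltW.
lra.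
Qed.
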